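(* Every polyomino $P$ is $C_4$-face-magic. That is, for every polyomino $P$, identified with its associated plane graph with vertex set $V(P)$, there exist a bijection $f: V(P)\to\{1,2,\dots,|V(P)|\}$ and a constant $c$ such that for every face $F$ of $P$ with $F\cong C_4$, the sum of the labels $f(v)$ over the four vertices $v$ of the bounding $4$-cycle equals $c$.
   Context: A polyomino is a finite edge-connected union of unit squares (cells) in the square lattice $\mathbb{Z}^2$: the cells are unit squares with corners in $\mathbb{Z}^2$, there are finitely many (and at least one), and any two cells are joined by a sequence of cells in which consecutive cells share a lattice edge. A polyomino is identified with its associated plane graph, whose vertices are the lattice points that are corners of its cells and whose edges are the unit lattice edges that are sides of its cells. Polyominoes are not assumed to be simply connected: they may have holes, in which case bounded faces other than the cells may occur. For a planar graph $G=(V,E)$ embedded in $\mathbb{R}^2$, let $\mathcal{F}(G)$ denote its set of faces. $G$ is called $C_n$-face-magic if there exist a bijection $f: V(G)\to\{1,2,\dots,|V(G)|\}$ and a constant $c$ such that for every $F\in\mathcal{F}(G)$ with $F\cong C_n$ (i.e. the face is bounded by a cycle with $n$ vertices), the sum of all the vertex labels along that cycle equals $c$. *)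

(* Defs.v *)
From mathcomp Require Import all_boot all_order all_algebra finmap.
From mathcomp Require Import all_classical all_reals all_analysis.

Set Implicit Arguments.
Unset Strict Implicit.
Unset Printing Implicit Defensive.

Import Order.TTheory GRing.Theory Num.Theory.
Import numFieldNormedType.Exports.

Local Open Scope classical_set_scope.
Local Open Scope fset_scope.
Local Open Scope ring_scope.

Definition lattice_point : Type := (int * int)%type.

Definition lattice_edge (u v : lattice_point) : bool :=
  `|u.1 - v.1| + `|u.2 - v.2| == 1.

(* The cell [i, i+1] x [j, j+1] is represented by its corner (i, j). *)
Definition corners (c : lattice_point) : seq lattice_point :=
  [:: c; (c.1 + 1, c.2); (c.1 + 1, c.2 + 1); (c.1, c.2 + 1)].

Definition side (c u v : lattice_point) : bool :=
  [&& u \in corners c, v \in corners c & lattice_edge u v].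

Definition share_edge (c d : lattice_point) : bool :=
  has (fun u => has (fun v => side c u v && side d u v) (corners c))
      (corners c).

Definition edge_connected (P : {fset lattice_point}) : Prop :=
  forall c d, c \in P -> d \in P ->
    exists p : seq lattice_point,
      [/\ all (mem P) p, path share_edge c p & last c p = d].

Record polyomino := Polyomino {
  cells : {fset lattice_point};
  cells_neq0 : cells != fset0;
  cells_connected : edge_connected cells }.

(* Finite simple graphs on lattice points; below they are drawn in the plane
   with straight segments as edges.  Planarity is not required here, but unit
   lattice edges meet only at common ends. *)
Record lattice_graph := LatticeGraph {
  vertices : {fset lattice_point};
  adj : rel lattice_point;
  adj_sym : symmetric adj;
  adj_irr : irreflexive adj;
  adj_vertices : forall u v, adj u v -> u \in vertices }.

Definition polyomino_vertices (P : polyomino) : {fset lattice_point} :=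
  [fset v | c in cells P, v in corners c].

Definition polyomino_adj (P : polyomino) (u v : lattice_point) : bool :=
  [exists c : cells P, side (val c) u v].

Lemma polyomino_adj_sym P : symmetric (polyomino_adj P).
Proof.
move=> u v; apply: eq_existsb => c.
by rewrite /side /lattice_edge andbCA distrC [ `|u.2 - v.2|]distrC.
Qed.

Lemma polyomino_adj_irr P : irreflexive (polyomino_adj P).
Proof.
move=> u; apply/existsP => -[c /and3P[_ _]].
by rewrite /lattice_edge !subrr.
Qed.

Lemma polyomino_adj_vertices P u v :
  polyomino_adj P u v -> u \in polyomino_vertices P.
Proof.
move=> /existsP[c /and3P[uc _ _]].
by apply/imfset2P; exists (val c); [exact: valP|exists u].
Qed.

Definition polyomino_graph (P : polyomino) : lattice_graph :=
  LatticeGraph (@polyomino_adj_sym P) (@polyomino_adj_irr P)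
    (@polyomino_adj_vertices P).

Definition embed (R : realType) (u : lattice_point) : R * R := (u.1%:~R, u.2%:~R).

Definition segment (R : realType) (u v : lattice_point) : set (R * R) :=
  [set (1 - t) *: embed R u + t *: embed R v | t in `[0, 1]].
Arguments segment : clear implicits.

Definition drawing (R : realType) (G : lattice_graph) : set (R * R) :=
  (embed R @` [set` vertices G]) `|`
  \bigcup_(e in [set e : lattice_point * lattice_point | adj G e.1 e.2]) segment R e.1 e.2.
Arguments drawing : clear implicits.

(* All faces, including the unbounded one. *)
Definition faces (R : realType) (G : lattice_graph) : set (set (R * R)) :=
  [set connected_component (~` drawing R G) z | z in ~` drawing R G].
Arguments faces : clear implicits.

Definition frontier (R : realType) (F : set (R * R)) : set (R * R) :=
  closure F `\` interior F.

Definition graph_cycle (G : lattice_graph) (n : nat) (p : seq lattice_point) : Prop :=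
  [/\ (2 < n)%N, size p = n & ucycle (adj G) p].

Definition cycle_drawing (R : realType) (p : seq lattice_point) : set (R * R) :=
  \bigcup_(v in [set` p]) segment R v (next p v).
Arguments cycle_drawing : clear implicits.

Definition bounded_by (R : realType) (F : set (R * R)) (p : seq lattice_point) : Prop :=
  frontier F = cycle_drawing R p.

(* Labels outside [vertices G] are irrelevant. *)
Definition face_magic (R : realType) (n : nat) (G : lattice_graph) : Prop :=
  exists (f : lattice_point -> nat) (c : nat),
    set_bij [set` vertices G] [set k | (1 <= k <= #|` vertices G|)%N] f /\
    forall F p, faces R G F -> graph_cycle G n p -> bounded_by F p ->
      (\sum_(v <- p) f v)%N = c.

(* Main.v *)
(* Every 4-cycle of the graph is a unit lattice square, so it suffices to label
   the vertex set V so that the two ends of a horizontal edge with left end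
   (i, j) have a label sum depending only on the parity of i + j: the horizontal
   edges of a square have opposite parities.  Cut V into maximal horizontal
   runs.
   - If some run is odd, the runs can be concatenated, some of them reversed,
     into one sequence in which the offset of each edge has the parity of i + j;
     label this sequence 1, N, 2, N-1, 3, ...  If some vertical run is odd,
     transpose.
   - Otherwise concatenate the runs starting at even i + j into one sequence and
     the others into a second one; both have size N/2.  Label them
     1, N-1, 3, N-3, ... and N, 2, N-2, 4, ... respectively. *)

Require Import Defs.
From mathcomp Require Import all_boot all_order all_algebra.
From mathcomp Require Import finmap.
From mathcomp Require Import all_classical all_reals all_analysis.
From mathcomp Require Import zify ring.

Import Order.TTheory GRing.Theory Num.Theory.

Section Labelling.
Local Open Scope ring_scope.
Implicit Types (u v : lattice_point) (r : lattice_point * nat).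

(** * Horizontal runs and their arrangement into sequences *)

Definition right u : lattice_point := (u.1 + 1, u.2).

Definition parity u : bool := odd (absz (u.1 + u.2)).

(* A run is encoded by its leftmost point and its number of points. *)
Definition run_points r : seq lattice_point :=
  [seq (r.1.1 + k%:Z, r.1.2) | k <- iota 0 r.2].

Definition points (rs : seq (lattice_point * nat)) : seq lattice_point :=
  flatten (map run_points rs).

(** The second clause expresses the maximality of the runs. *)
Definition covers (rs : seq (lattice_point * nat)) (V : seq lattice_point) :
    Prop :=
  perm_eq (points rs) V /\
  forall u, u \in V -> right u \in V ->
    exists r, [/\ r \in rs, u \in run_points r & right u \in run_points r].

(* [u] and [v] are neighbours in [s], in either order, the first of them at an
   offset of parity [b]. *)
Definition linked (s : seq lattice_point) u v (b : bool) : Prop :=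
  exists s1 s2, odd (size s1) = b /\
    (s = s1 ++ [:: u, v & s2] \/ s = s1 ++ [:: v, u & s2]).

(** [b] is the parity of the offset at which [s] is to be inserted into a longer sequence, in which
    the offset of each edge must have the parity of its left end. *)
Definition realizable (rs : seq (lattice_point * nat)) (b : bool) : Prop :=
  exists2 s, perm_eq s (points rs) & forall r u, r \in rs ->
    u \in run_points r -> right u \in run_points r ->
    linked s u (right u) (parity u (+) b).

Lemma mem_run_points r u :
  reflect (exists2 k, (k < r.2)%N & u = (r.1.1 + k%:Z, r.1.2))
          (u \in run_points r).
Proof.
apply: (iffP mapP) => -[k]; rewrite ?mem_iota => kr ->; exists k => //.
by rewrite mem_iota.
Qed.

Lemma size_run_points r : size (run_points r) = r.2.
Proof. by rewrite size_map size_iota. Qed.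

Lemma uniq_run_points r : uniq (run_points r).
Proof. by rewrite map_inj_uniq ?iota_uniq// => k l [] /=; lia. Qed.

Lemma linked_run r u : u \in run_points r -> right u \in run_points r ->
  linked (run_points r) u (right u) (parity u (+) parity r.1).
Proof.
move=> /mem_run_points[k kr uE] /mem_run_points[k' kr' /eqP].
rewrite uE xpair_eqE/= => /andP[/eqP kk' _].
have {}kk' : (k' = k.+1)%N by lia.
rewrite kk' in kr'; rewrite /run_points.
have -> : r.2 = (k + (2 + (r.2 - k - 2)))%N by lia.
rewrite iotaD map_cat; do 2!eexists; split; last first.
  by left; rewrite /= /right /=; congr (_ ++ _ :: (_, _) :: _); lia.
by rewrite size_map size_iota /parity /=; lia.
Qed.

(** * Parity of offsets under concatenation and reversal *)

Lemma linked_catl s t u v b : linked s u v b -> linked (s ++ t) u v b.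
Proof.
move=> [s1 [s2 [sb sE]]]; exists s1, (s2 ++ t); split=> //.
by case: sE => ->; rewrite -catA; [left|right].
Qed.

Lemma linked_catr s t u v b :
  linked t u v b -> linked (s ++ t) u v (odd (size s) (+) b).
Proof.
move=> [s1 [s2 [<- tE]]]; exists (s ++ s1), s2; rewrite size_cat oddD.
split=> //.
by case: tE => ->; rewrite catA; [left|right].
Qed.

(** In a sequence of length [n], reversal moves an edge from offset [k] to offset [n - 2 - k]. *)
Lemma linked_rev s u v b : linked s u v b ->
  linked (rev s) u v (odd (size s) (+) b).
Proof.
move=> [s1 [s2 [<- sE]]]; exists (rev s2), (rev s1); split.
  by case: sE => ->; rewrite size_rev size_cat /=; lia.
by case: sE => ->; rewrite rev_cat !rev_cons -!cats1 -!catA; [right|left].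
Qed.

Lemma points_cat rs rs' : points (rs ++ rs') = points rs ++ points rs'.
Proof. by rewrite /points map_cat flatten_cat. Qed.

Lemma perm_points rs rs' : perm_eq rs rs' -> perm_eq (points rs) (points rs').
Proof. by move=> rr'; apply/perm_flatten/perm_map. Qed.

Lemma realizable_perm rs rs' b : perm_eq rs rs' ->
  realizable rs b -> realizable rs' b.
Proof.
move=> rr' [s srs sl]; exists s.
  exact: perm_trans srs (perm_points _ _ rr').
by move=> r u; rewrite -(perm_mem rr'); exact: sl.
Qed.

Lemma realizable_cat rs rs' b : realizable rs b ->
  realizable rs' (odd (size (points rs)) (+) b) -> realizable (rs ++ rs') b.
Proof.
move=> [s srs sl] [s' srs' sl']; exists (s ++ s').
  by rewrite points_cat; exact: perm_cat.
move=> r u; rewrite mem_cat => /orP[rrs|rrs'] ur ur'.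
  by apply: linked_catl; exact: sl ur ur'.
have /(linked_catr s) := sl' _ _ rrs' ur ur'.
by rewrite (perm_size srs); case: (odd _) (parity u) b {sl sl'} => [] [] [].
Qed.

Lemma realizable0 b : realizable [::] b.
Proof. by exists [::]. Qed.

(** Read forwards, a run fits the shift [parity r.1]. Reversal changes this shift by the parity of
    the length, so an odd run fits both shifts. *)
Lemma realizable1 r b : odd r.2 || (parity r.1 == b) -> realizable [:: r] b.
Proof.
move=> rb; have [<-|prb] := eqVneq (parity r.1) b.
  exists (run_points r); first by rewrite /points /= cats0.
  by move=> _ u /[1!inE]/eqP-> ur ur'; exact: linked_run.
have {rb}r2 : odd r.2 by move: rb; rewrite (negbTE prb) orbF.
exists (rev (run_points r)); first by rewrite /points /= cats0 perm_rev.
move=> _ u /[1!inE]/eqP-> ur ur'.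
have := linked_rev _ _ _ _ (linked_run _ _ ur ur').
by rewrite size_run_points r2; case: (parity u) (parity r.1) b prb => [] [] [].
Qed.

Lemma realizable_even rs b :
  {in rs, forall r, ~~ odd r.2 /\ parity r.1 = b} -> realizable rs b.
Proof.
elim: rs => [|r rs IH] rsE; first exact: realizable0.
have [r2 rb] := rsE r (mem_head _ _).
rewrite -cat1s; apply: realizable_cat.
  by apply: realizable1; rewrite rb eqxx orbT.
rewrite /points /= cats0 size_run_points (negbTE r2) /=.
by apply: IH => q qrs; apply: rsE; rewrite inE qrs orbT.
Qed.

Lemma realizable_odd rs b : {in rs, forall r, odd r.2} -> realizable rs b.
Proof.
elim: rs b => [|r rs IH] b rsO; first exact: realizable0.
rewrite -cat1s; apply: realizable_cat.
  by apply: realizable1; rewrite rsO ?mem_head.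
by apply: IH => q qrs; apply: rsO; rewrite inE qrs orbT.
Qed.

Lemma even_points rs : {in rs, forall r, ~~ odd r.2} ->
  ~~ odd (size (points rs)).
Proof.
elim: rs => [|r rs IH] // rsE.
rewrite /points /= size_cat size_run_points oddD.
rewrite (negbTE (rsE r (mem_head _ _))) /=.
by apply: IH => q qrs; apply: rsE; rewrite inE qrs orbT.
Qed.

Definition evens b rs := [seq r <- rs | ~~ odd r.2 & parity r.1 == b].

Lemma evensP b rs : {in evens b rs, forall r, ~~ odd r.2 /\ parity r.1 = b}.
Proof. by move=> r; rewrite mem_filter => /andP[/andP[? /eqP ?] _]. Qed.

(* An odd run may be traversed in either direction, hence can sit at an offset
   of either parity, and it shifts the parity of the offsets after it. *)
Lemma realizable_has_odd rs : has (fun r => odd r.2) rs -> realizable rs false.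
Proof.
move=> rsO; set os := [seq r <- rs | odd r.2].
have perm_rs : perm_eq (evens false rs ++ os ++ evens true rs) rs.
  rewrite perm_sym -(perm_filterC (fun r => odd r.2) rs) perm_sym perm_catCA.
  rewrite perm_cat2l perm_sym -(perm_filterC (fun r => parity r.1)) perm_catC.
  by apply: perm_cat; apply/permP => a; rewrite !count_filter;
    apply: eq_count => r /=; lia.
case E : os perm_rs => [|r0 os'] perm_rs.
  by move: rsO; rewrite has_filter -/os E.
have osO : {in r0 :: os', forall r, odd r.2}.
  by move=> r; rewrite -E mem_filter => /andP[].
(* The first block has even size, [r0] then makes the offset odd as [evens true rs] requires, and
   the other odd runs fit anywhere. *)
have {}perm_rs : perm_eq (evens false rs ++ [:: r0] ++ evens true rs ++ os') rs.
  by apply: perm_trans perm_rs; rewrite perm_cat2l perm_cat2l perm_catC.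
apply: realizable_perm perm_rs _; apply: realizable_cat.
  exact/realizable_even/evensP.
rewrite (negbTE (even_points _ _)); last by move=> r /evensP[].
apply: realizable_cat; first by apply: realizable1; rewrite osO ?mem_head.
rewrite {1}/points /= cats0 size_run_points osO ?mem_head//=.
apply: realizable_cat; first exact/realizable_even/evensP.
by apply: realizable_odd => r ros; apply: osO; rewrite inE ros orbT.
Qed.

(** * Decomposition into maximal runs *)

(** Pigeonhole: [V] cannot contain [(size V).+1] distinct points of the line. The directions -1 and
    1 locate the two ends of a run. *)
Lemma line_leaves (V : seq lattice_point) u (d : int) : d != 0 ->
  exists n : nat, (u.1 + d * n%:Z, u.2) \notin V.
Proof.
move=> d0; apply/not_existsP => inV.
pose s := [seq (u.1 + d * n%:Z, u.2) : lattice_point | n <- iota 0 (size V).+1].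
have us : uniq s.
  rewrite map_inj_uniq ?iota_uniq// => m n [] /addrI /(mulfI d0); lia.
have sV : {subset s <= V}.
  by move=> _ /mapP[n _ ->]; have /negP := inV n; rewrite negbK.
by have := uniq_leq_size us sV; rewrite size_map size_iota ltnn.
Qed.

(** Induction on the size: a maximal run is split off, and no horizontal edge joins it to the
    remaining points [W]. *)
Lemma exists_covers V : uniq V -> exists rs, covers rs V.
Proof.
have [n] := ubnP (size V); elim: n V => // n IH [|v0 V0]; first by exists [::].
set V := v0 :: V0 => Vn uV.
(* [v] is the last point of [V] met when walking left from [v0], so a maximal run starts there. *)
have [v vV vL] : exists2 v, v \in V & forall u, u \in V -> right u != v.
  have [/= m mV mmin] := ex_minnP (line_leaves V v0 (-1) isT).
  case: m mV mmin => [|m] mV mmin.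
    by move: mV; rewrite mulr0 addr0 -surjective_pairing mem_head.
  exists (v0.1 - m%:Z, v0.2).
    apply: contraTT isT => mV'; have := mmin m; rewrite mulN1r mV' ltnn.
    by move=> /(_ isT).
  move=> u uV'; apply: contraNneq mV => -[u1 u2].
  by rewrite (_ : (_, _) = u)// [RHS]surjective_pairing;
    congr (_, _) => //; lia.
(* The first exit to the right of [v] gives the length [l] of its run. *)
have [/= l lV lmin] := ex_minnP (line_leaves V v 1 isT).
pose W := [seq u <- V | u \notin run_points (v, l)].
have memr k : (k < l)%N -> (v.1 + k%:Z, v.2) \in V.
  by move=> kl; apply: contraTT kl => kV; rewrite -leqNgt lmin// mul1r.
have rV u : u \in run_points (v, l) -> u \in V.
  by move=> /mem_run_points[k kl ->]; exact: memr.
have l0 : (0 < l)%N.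
  rewrite lt0n; apply: contraTneq vV => l0; move: lV.
  by rewrite l0 mulr0 addr0 -surjective_pairing.
have vr : v \in run_points (v, l).
  by apply/mem_run_points; exists 0%N => //=; rewrite addr0 -surjective_pairing.
have permV : perm_eq (run_points (v, l) ++ W) V.
  apply: uniq_perm => //.
    rewrite cat_uniq uniq_run_points filter_uniq// andbT /=; apply/hasPn => u.
    by rewrite mem_filter => /andP[].
  move=> u; rewrite mem_cat mem_filter.
  case: (boolP (u \in run_points _)) => //=.
  by move=> /rV ->.
have [rs [rsW rsadj]] : exists rs, covers rs W.
  apply: IH; last exact: filter_uniq.
  have := perm_size permV; rewrite size_cat size_run_points /= in Vn *; lia.
exists ((v, l) :: rs); split.
  by apply: perm_trans permV; rewrite /points /= perm_cat2l.
move=> u uV' ruV; have [ur|ur] := boolP (u \in run_points (v, l)).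
  exists (v, l); split=> //; first exact: mem_head.
  have /mem_run_points[/= k kl uE] := ur.
  apply/mem_run_points; exists k.+1 => /=; last first.
    by rewrite uE /right /=; congr (_, _); lia.
  rewrite ltn_neqAle kl andbT; apply: contraNneq lV => <-.
  by rewrite (_ : (_, _) = right u)// uE /right /=; congr (_, _); lia.
have [r [rrs ur' rur']] : exists r,
    [/\ r \in rs, u \in run_points r & right u \in run_points r].
  apply: rsadj; rewrite mem_filter; first by rewrite ur uV'.
  (* If [right u] were in the removed run, it would either be its first point [v], which has no left
     neighbour in [V], or put [u] in the run too. *)
  rewrite ruV andbT; apply: contra ur => /mem_run_points[/= [|k] kl ruE].
    by have := vL u uV'; rewrite ruE addr0 -surjective_pairing eqxx.
  apply/mem_run_points; exists k => /=; first exact: ltnW.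
  case: ruE => u1 u2; rewrite [LHS]surjective_pairing; congr (_, _) => //; lia.
by exists r; rewrite inE rrs orbT.
Qed.

(** * Signed coordinate sums over even runs *)

Definition sign u : int := (-1) ^+ parity u.

Lemma sum_run_points m u (F : lattice_point -> int) :
  \sum_(v <- run_points (u, m.+2)) F v =
  \sum_(v <- run_points (u, m)) F v +
    (F (u.1 + m%:Z, u.2) + F (u.1 + m.+1%:Z, u.2)).
Proof.
rewrite /run_points (_ : (u, m.+2).2 = m + 2)%N; last by rewrite addn2.
rewrite iotaD map_cat big_cat /=; congr (_ + _).
by rewrite !big_cons big_nil addr0.
Qed.

Lemma sign_even u m : sign (u.1 + m.*2%:Z, u.2) = sign u.
Proof. by rewrite /sign /parity /=; congr (_ ^+ nat_of_bool _); lia. Qed.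

Lemma sign_odd u m : sign (u.1 + m.*2.+1%:Z, u.2) = - sign u.
Proof.
rewrite /sign; have -> : parity (u.1 + m.*2.+1%:Z, u.2) = ~~ parity u.
  by rewrite /parity /=; lia.
by case: (parity u).
Qed.

(** The second coordinate is constant along the run, so consecutive points cancel in pairs. *)
Lemma sum_sign_snd r : ~~ odd r.2 -> \sum_(u <- run_points r) sign u * u.2 = 0.
Proof.
case: r => u l /= /even_halfK <-; elim: l./2 => [|m IH].
  by rewrite big_nil.
by rewrite doubleS sum_run_points IH sign_even sign_odd /=; ring.
Qed.

(** Each of the [r.2 / 2] pairs of consecutive points contributes [- sign r.1]; the factor 2 avoids
    the division. *)
Lemma sum_sign_fst r : ~~ odd r.2 ->
  2 * \sum_(u <- run_points r) sign u * u.1 = - (sign r.1 * r.2%:Z).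
Proof.
case: r => u l /= /even_halfK <-; elim: l./2 => [|m IH].
  by rewrite big_nil !mulr0 oppr0.
rewrite doubleS sum_run_points mulrDr IH sign_even sign_odd /=.
by rewrite !intS; ring.
Qed.

Lemma sum_points rs (F : lattice_point -> int) :
  \sum_(u <- points rs) F u = \sum_(r <- rs) \sum_(u <- run_points r) F u.
Proof. by rewrite /points big_flatten big_map. Qed.

Lemma sum_sign_runs rs : {in rs, forall r, ~~ odd r.2} ->
  \sum_(r <- rs) sign r.1 * r.2%:Z =
  (size (points (evens false rs)))%:Z - (size (points (evens true rs)))%:Z.
Proof.
elim: rs => [|r rs IH] rsE; first by rewrite big_nil.
rewrite big_cons IH => [|q qrs]; last by apply: rsE; rewrite inE qrs orbT.
rewrite /evens /= (rsE r (mem_head _ _)) /= /sign.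
by case: (parity r.1); rewrite /points /= size_cat size_run_points PoszD; ring.
Qed.

Definition transpose u : lattice_point := (u.2, u.1).

Lemma sign_transpose u : sign (transpose u) = sign u.
Proof. by rewrite /sign /parity /= addrC. Qed.

(* The sum of (-1)^(i + j) i over V vanishes column by column, while each row
   run contributes half its length, with a sign. *)
Lemma evens_balanced V rs cs : covers rs V -> covers cs (map transpose V) ->
  {in rs, forall r, ~~ odd r.2} -> {in cs, forall r, ~~ odd r.2} ->
  size (points (evens false rs)) = size (points (evens true rs)).
Proof.
move=> [rsV _] [csV _] rsE csE.
have V0 : \sum_(u <- V) sign u * u.1 = 0.
  have -> : \sum_(u <- V) sign u * u.1 =
            \sum_(u <- map transpose V) sign u * u.2.
    by rewrite big_map; apply: eq_bigr => u _; rewrite sign_transpose.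
  rewrite -(perm_big _ csV) sum_points big_seq big1// => r rcs.
  exact/sum_sign_snd/csE.
have : 2 * \sum_(u <- V) sign u * u.1 = - \sum_(r <- rs) sign r.1 * r.2%:Z.
  rewrite -(perm_big _ rsV) sum_points mulr_sumr -sumrN big_seq [RHS]big_seq.
  by apply: eq_bigr => r /rsE; exact: sum_sign_fst.
rewrite V0 sum_sign_runs//; lia.
Qed.

(** * Label sums along a sequence *)

Lemma linked_sum s u v b (g : nat -> nat) (S : bool -> nat) : uniq s ->
  linked s u v b ->
  (forall k, (k.+1 < size s)%N -> (g k + g k.+1)%N = S (odd k)) ->
  (g (index u s) + g (index v s))%N = S b.
Proof.
move=> us [s1 [s2 [<- sE]]] gS.
wlog sE' : u v {sE} / s = s1 ++ [:: u, v & s2] => [H|].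
  by case: sE => sE; [|rewrite addnC]; apply: H.
have s1s : ((size s1).+1 < size s)%N.
  by rewrite sE' size_cat !addnS !ltnS leq_addr.
rewrite -gS//; congr (g _ + g _)%N.
  by rewrite -[RHS](index_uniq u _ us)// 1?ltnW// sE' nth_cat ltnn subnn.
by rewrite -[RHS](index_uniq u _ us)// sE' nth_cat ltnNge leqnSn /= subSnn.
Qed.

(* 1, N, 2, N-1, 3, ... *)
Definition zigzag N k := (if odd k then N - k./2 else k./2.+1)%N.

Lemma zigzag_inj N k l : (k < N -> l < N -> zigzag N k = zigzag N l -> k = l)%N.
Proof. by rewrite /zigzag; do 2!case: ifP; lia. Qed.

Lemma zigzag_range N k : (k < N -> 1 <= zigzag N k <= N)%N.
Proof. by rewrite /zigzag; case: ifP; lia. Qed.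

Lemma zigzag_sum N k :
  (k.+1 < N -> zigzag N k + zigzag N k.+1 = N + 1 + odd k)%N.
Proof. by rewrite /zigzag /= uphalf_half; case: ifP => /=; lia. Qed.

(* 1, N-1, 3, N-3, ... for [b = false] and N, 2, N-2, 4, ... for [b = true]. *)
Definition alternate N b k := (if odd k (+) b then N - k else k.+1)%N.

(** This keeps the labels of the two sequences disjoint. *)
Lemma odd_alternate N b k : ~~ odd N -> (k < N)%N ->
  odd (alternate N b k) = ~~ b.
Proof. by rewrite /alternate; case: b; case Ek: (odd k) => /=; lia. Qed.

(** A rising label [k + 1] meets a falling label [N - l] only if [k + l = N - 1], out of reach for
    two indices below [N / 2]. *)
Lemma alternate_inj N b k l : ~~ odd N ->
  (k.*2 < N -> l.*2 < N -> alternate N b k = alternate N b l -> k = l)%N.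
Proof.
by rewrite /alternate; case: b; case Ek: (odd k); case El: (odd l) => /=; lia.
Qed.

Lemma alternate_range N b k : (k < N -> 1 <= alternate N b k <= N)%N.
Proof. by rewrite /alternate; case: ifP; lia. Qed.

(** For a sequence realizing shift [b], [odd k (+) b] is the parity of the left end of the edge, so
    both sequences obey the same rule for edge sums. *)
Lemma alternate_sum N b k :
 (k.+1 < N -> alternate N b k + alternate N b k.+1 = N + (odd k (+) b).*2)%N.
Proof. by rewrite /alternate /=; case: b (odd k) => [] [] /=; lia. Qed.

(** * Labellings with constant sum on unit squares *)

Definition labelling V (f : lattice_point -> nat) : Prop :=
  {in V &, injective f} /\ {in V, forall u, 1 <= f u <= size V}%N.

Lemma labelling_onto V f k : uniq V -> labelling V f ->
  (1 <= k <= size V)%N -> exists2 u, u \in V & f u = k.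
Proof.
move=> uV [f_inj f_range] kV; suff /mapP[u uV' ->] : k \in map f V by exists u.
have ufV : uniq (map f V) by rewrite map_inj_in_uniq.
have fV : {subset map f V <= iota 1 (size V)}.
  by move=> _ /mapP[u uV' ->]; rewrite mem_iota add1n ltnS f_range.
have [|_ ->] := uniq_min_size ufV fV; first by rewrite size_map size_iota.
by rewrite mem_iota add1n ltnS.
Qed.

(** This depends on the point set alone: it concerns every unit square with corners in [V], be it a
    cell or a hole. *)
Definition square_magic V : Prop :=
  exists f c, labelling V f /\
    forall u, {subset corners u <= V} -> (\sum_(v <- corners u) f v)%N = c.

Lemma square_magic_edges V f (S : bool -> nat) : labelling V f ->
  (forall u, u \in V -> right u \in V ->
    (f u + f (right u))%N = S (parity u)) ->
  square_magic V.
Proof.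
move=> fV fS; exists f, (S false + S true)%N; split=> // u uV.
have uV' v : v \in corners u -> v \in V by exact: uV.
have := fS (u.1, u.2 + 1); have := fS u; rewrite !uV' ?inE ?eqxx ?orbT//=.
  rewrite /corners !big_cons big_nil.
  have -> : parity (u.1, u.2 + 1) = ~~ parity u by rewrite /parity /=; lia.
  move=> /(_ isT isT) + /(_ isT isT); rewrite /right /=.
  by case: (parity u) => /=; lia.
Qed.

Lemma square_magic_odd V rs : uniq V -> covers rs V ->
  has (fun r => odd r.2) rs ->
  square_magic V.
Proof.
move=> uV [rsV rsadj] /realizable_has_odd[s srs sl].
have sV := perm_trans srs rsV.
have us : uniq s by rewrite (perm_uniq sV).
pose N := size V; have sN : size s = N by exact: perm_size.
pose g := zigzag N; pose S (b : bool) := (N + 1 + b)%N.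
apply: (@square_magic_edges _ (fun u => g (index u s)) S); first split.
- move=> u v; rewrite -!(perm_mem sV) => us' vs' guv.
  rewrite -(nth_index u us') -[RHS](nth_index u vs'); congr nth.
  by apply: zigzag_inj guv; rewrite -sN index_mem.
- move=> u; rewrite -(perm_mem sV) => us'; apply: zigzag_range.
  by rewrite -/N -sN index_mem.
move=> u uV' ruV; have [r [rrs ur rur]] := rsadj u uV' ruV.
apply: (linked_sum _ _ _ _ _ _ us).
  by have := sl r u rrs ur rur; rewrite addbF.
by move=> k; rewrite sN; exact: zigzag_sum.
Qed.

(** The equality of sizes gives each sequence [N / 2] points, the range where [alternate] is
    injective. *)
Lemma square_magic_even V rs : uniq V -> covers rs V ->
  {in rs, forall r, ~~ odd r.2} ->
  size (points (evens false rs)) = size (points (evens true rs)) ->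
  square_magic V.
Proof.
move=> uV [rsV rsadj] rsE sizeE.
have [s1 s1rs sl1] := realizable_even _ _ (evensP false rs).
have [s2 s2rs sl2] := realizable_even _ _ (evensP true rs).
have perm_rs : perm_eq (evens false rs ++ evens true rs) rs.
  rewrite perm_catC perm_sym -(perm_filterC (fun r => parity r.1) rs).
  rewrite /evens; apply: perm_cat; apply/permP => a; rewrite !count_filter;
    apply: eq_in_count => r /rsE /=; lia.
have sV : perm_eq (s1 ++ s2) V.
  apply: perm_trans rsV; apply: perm_trans (perm_points _ _ perm_rs).
  by rewrite points_cat perm_cat.
have : uniq (s1 ++ s2) by rewrite (perm_uniq sV).
rewrite cat_uniq => /and3P[us1 s12 us2].
pose N := size V.
have even1 : ~~ odd (size s1).
  by rewrite (perm_size s1rs); apply: even_points => r /evensP[].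
have s1N : (size s1).*2 = N.
  rewrite -[N](perm_size sV) size_cat.
  by rewrite (perm_size s1rs) (perm_size s2rs) -sizeE addnn.
have s2N : size s2 = size s1 by rewrite (perm_size s1rs) (perm_size s2rs).
have N_even : ~~ odd N by rewrite -s1N odd_double.
pose f u := if u \in s1 then alternate N false (index u s1)
            else alternate N true (index u s2).
pose S (b : bool) := (N + b.*2)%N.
have s1_le_N : (size s1 <= N)%N by rewrite -s1N -addnn leq_addr.
have in2 u : u \in V -> u \notin s1 -> u \in s2.
  by rewrite -(perm_mem sV) mem_cat => /orP[->|].
have in1 u : u \in s2 -> u \in s1 = false.
  by move=> us; apply/negbTE/(hasPn s12).
have ltN s u : size s = size s1 -> u \in s -> (index u s < N)%N.
  by move=> ss; rewrite -index_mem ss => /leq_trans; apply.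
have ltN2 s u : size s = size s1 -> u \in s -> ((index u s).*2 < N)%N.
  by move=> ss; rewrite -index_mem ss -s1N ltn_double.
have alternate_index_inj b s : size s = size s1 ->
    {in s &, injective (fun u => alternate N b (index u s))}.
  move=> ss u v us vs guv.
  rewrite -(nth_index u us) -[RHS](nth_index u vs); congr nth.
  by apply: alternate_inj guv => //; exact: ltN2.
have f1_neq_f2 u v : u \in s1 -> v \in s2 ->
    alternate N false (index u s1) != alternate N true (index v s2).
  move=> us vs; apply/eqP => /(congr1 odd).
  by rewrite !odd_alternate// ltN.
apply: (@square_magic_edges _ f S); first split.
- move=> u v uV' vV; rewrite /f.
  have [us|/(in2 _ uV') us] := boolP (u \in s1);
    have [vs|/(in2 _ vV) vs] := boolP (v \in s1) => guv.
  + exact: alternate_index_inj guv.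
  + by have := f1_neq_f2 _ _ us vs; rewrite guv eqxx.
  + by have := f1_neq_f2 _ _ vs us; rewrite guv eqxx.
  + exact: alternate_index_inj guv.
- move=> u uV'; rewrite /f; have [us|/(in2 _ uV') us] := boolP (u \in s1);
    by apply: alternate_range; exact: ltN.
move=> u uV' ruV; have [r [rrs ur rur]] := rsadj u uV' ruV.
have inrun b s : perm_eq s (points (evens b rs)) -> parity r.1 = b ->
    [/\ r \in evens b rs, u \in s & right u \in s].
  move=> ss rb; have re : r \in evens b rs.
    by rewrite mem_filter rsE// rrs rb eqxx.
  by split=> //; rewrite (perm_mem ss); apply/flattenP;
    exists (run_points r) => //; exact: map_f.
have sum_s b s : uniq s -> size s = size s1 ->
    linked s u (right u) (parity u (+) b) ->
    (alternate N b (index u s) + alternate N b (index (right u) s))%N =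
      S (parity u).
  move=> us ss slink.
  (* Linkage gives the offset parity [parity u (+) b]; the second shift by [b] cancels the first. *)
  rewrite (linked_sum _ _ _ _ _ (fun c => S (c (+) b)) us slink)
    -?addbA ?addbb ?addbF//.
  by move=> k; rewrite ss => /leq_trans ks; apply/alternate_sum/ks.
case rb : (parity r.1).
  have [re us rus] := inrun _ _ s2rs rb.
  by rewrite /f !in1//; apply: sum_s => //; exact: sl2 re ur rur.
have [re us rus] := inrun _ _ s1rs rb.
by rewrite /f us rus; apply: sum_s => //; exact: sl1 re ur rur.
Qed.

Lemma square_magic_transpose V : square_magic (map transpose V) ->
  square_magic V.
Proof.
move=> [f [c [[finj fle] fc]]]; exists (f \o transpose), c; split; first split.
- move=> u v uV vV /= /finj => /(_ (map_f _ uV) (map_f _ vV)).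
  by case: u v {uV vV} => [? ?] [? ?] [-> ->].
- by move=> u uV; have := fle _ (map_f transpose uV); rewrite size_map.
move=> u uV; rewrite -(fc (transpose u)) => [|v vu].
  by rewrite /corners !big_cons !big_nil /transpose /=; lia.
have -> : v = transpose (transpose v) by case: (v).
apply/map_f/uV; move: vu {uV}; case: u v => u1 u2 [v1 v2].
by rewrite !inE !xpair_eqE /=; lia.
Qed.

Lemma uniq_square_magic V : uniq V -> square_magic V.
Proof.
move=> uV.
have uV' : uniq (map transpose V).
  by rewrite map_inj_uniq// => -[? ?] [? ?] [-> ->].
have [rs rsV] := exists_covers _ uV.
have [cs csV] := exists_covers _ uV'.
have [rsO|/hasPn rsE] := boolP (has (fun r => odd r.2) rs).
  exact: square_magic_odd rsO.
have [csO|/hasPn csE] := boolP (has (fun r => odd r.2) cs).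
  by apply: square_magic_transpose; exact: square_magic_odd csO.
exact/(square_magic_even _ _ uV rsV rsE)/(evens_balanced _ _ _ rsV csV).
Qed.

(** * Four-cycles of the lattice *)

Lemma lattice_edgeP u v : lattice_edge u v ->
  exists e : int * int, [/\ v = (u.1 + e.1, u.2 + e.2) &
    e \in [:: (1, 0); (-1, 0); (0, 1); (0, -1)]].
Proof.
case: u v => u1 u2 [v1 v2]; rewrite /lattice_edge /= => uv.
exists (v1 - u1, v2 - u2); rewrite /= !subrKC; split=> //.
by rewrite !inE !xpair_eqE; lia.
Qed.

Lemma lattice_cycle4 p : size p = 4 -> ucycle lattice_edge p ->
  exists u, perm_eq p (corners u).
Proof.
case: p => [|a [|b [|c [|d []]]]]// _ /andP[/and5P[ab bc cd da _]] up.
suff [u pu] : exists u, {subset [:: a; b; c; d] <= corners u}.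
  exists u; apply: uniq_perm => //; last by have [] := uniq_min_size up pu.
  exact: leq_size_uniq up pu _.
(* Distinct opposite vertices exclude closed walks that turn back. *)
have {}up : (a != c) && (b != d).
  by move: up; rewrite /= !inE !negb_or => /and4P[/and3P[_ -> _] /andP[_ ->]].
case: a ab da up => x y ab da up; move: ab bc cd da up.
move=> /lattice_edgeP[e [-> eE]] /lattice_edgeP[e' [-> eE']].
move=> /lattice_edgeP[e'' [-> eE'']] /=.
rewrite /lattice_edge /= !xpair_eqE => da up.
(* The points [a] and [c = a + e + e'] are opposite corners of the square, so its lower left corner
   is their coordinatewise minimum. *)
exists (x + Num.min 0 (e.1 + e'.1), y + Num.min 0 (e.2 + e'.2)) => v.
rewrite /corners !inE /=.
by move: eE eE' eE'' da up; rewrite !inE;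
  move=> /or4P[]/eqP-> /or4P[]/eqP-> /or4P[]/eqP->;
  rewrite /= => da up; try (exfalso; clear -da up; lia);
  move=> /or4P[]/eqP->; rewrite !xpair_eqE; clear; lia.
Qed.

End Labelling.

Theorem theorem4 (R : realType) (P : polyomino) :
  face_magic R 4 (polyomino_graph P).
Proof.
have uV := fset_uniq (polyomino_vertices P).
have [f [c [fV f_sum]]] := uniq_square_magic _ uV; have [f_inj f_range] := fV.
exists f, c; split.
  split=> [u|u v|k]; [exact: f_range| |exact: labelling_onto uV fV].
  by rewrite !inE; exact: f_inj.
move=> F p _ [_ p4 /andP[pcyc puniq]] _.
have [u pu] : exists u, perm_eq p (corners u).
  apply: lattice_cycle4 => //; apply/andP; split=> //.
  by apply: sub_cycle pcyc => v w /existsP[d /and3P[]].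
rewrite (perm_big _ pu); apply: f_sum => v; rewrite -(perm_mem pu) => vp.
(* Each point of the cycle is adjacent to its successor, hence is a vertex of the polyomino. *)
have := next_cycle pcyc vp; exact: polyomino_adj_vertices.
Qed.
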